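(* Let $G$ be an abelian group, $\mathbb{F}$ a field, $\mathcal{D}$ a $G$-graded associative $\mathbb{F}$-algebra which is a graded-division algebra, with grading $\Gamma_0$, support $T$ and identity component $\mathcal{D}_e$, and $\mathcal{V}$ a nonzero $G$-graded right $\mathcal{D}$-module of finite dimension $k$ over $\mathcal{D}$. Let $\Gamma$ be the induced $G$-grading on $\mathcal{R}=\operatorname{End}_{\mathcal{D}}(\mathcal{V})$. Assume that $(\mathcal{D},\mathcal{V})$ satisfies the fine condition. Then the stabilizer of $\Gamma$ is isomorphic to $$\operatorname{Stab}(\Gamma)\cong(\mathcal{D}_e^{\times})^{k-1}\rtimes\operatorname{Stab}(\Gamma_0),$$ where in this semidirect product $\operatorname{Stab}(\Gamma_0)$ acts on $(\mathcal{D}_e^{\times})^{k-1}$ componentwise.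
   Context: A graded-division algebra is a (nonzero) unital graded associative algebra in which every nonzero homogeneous element is invertible; its support $T=\{g\in G\mid\mathcal{D}_g\neq0\}$ is a subgroup of $G$. $e$ is the neutral element of $G$, and $\mathcal{D}_e^{\times}$ is the multiplicative group of nonzero (equivalently invertible) elements of $\mathcal{D}_e$. A $G$-graded right $\mathcal{D}$-module is $\mathcal{V}=\bigoplus_{g\in G}\mathcal{V}_g$ with $\mathcal{V}_g\mathcal{D}_h\subseteq\mathcal{V}_{gh}$; it is free with a homogeneous $\mathcal{D}$-basis. $\operatorname{End}_{\mathcal{D}}(\mathcal{V})$ is graded by: $r$ has degree $g$ if $r\mathcal{V}_h\subseteq\mathcal{V}_{gh}$ for all $h\in G$. The isotypic components of $\mathcal{V}$ are the nonzero subspaces among $\bigoplus_{h\in gT}\mathcal{V}_h$, $gT\in G/T$; let $g_1T,\dots,g_sT$ be their (distinct) supports and $k_1,\dots,k_s$ their $\mathcal{D}$-dimensions, so $k=k_1+\dots+k_s$. The pair $(\mathcal{D},\mathcal{V})$ satisfies the fine condition if $k_1=\dots=k_s=1$ and $g_ig_j^{-1}\not\equiv g_hg_\ell^{-1}\pmod T$ for all $i\neq j$ and $(i,j)\neq(h,\ell)$. For a grading $\Gamma$ on an $\mathbb{F}$-algebra $\mathcal{R}$, $\operatorname{Stab}(\Gamma)$ is the group of $\mathbb{F}$-algebra automorphisms $\psi$ of $\mathcal{R}$ with $\psi(\mathcal{R}_g)=\mathcal{R}_g$ for all $g$; similarly for $\Gamma_0$ on $\mathcal{D}$. *)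

(* Defs.v *)
(* MathComp, with the classical axioms of mathcomp.classical.boolp.           *)
(* The abelian group G is a zmodType, written additively: e is 0, gh is g + h *)
(* and g h^-1 is g - h.  A right D-module is a left module over the converse  *)
(* algebra D^c, so that [(d : D^c) *: v] is the right product v d.            *)
From HB Require Import structures.
From mathcomp Require Import all_boot all_order all_algebra.
From mathcomp Require Import boolp classical_sets.

Set Implicit Arguments.
Unset Strict Implicit.
Unset Printing Implicit Defensive.

Import GRing.Theory.
Local Open Scope classical_set_scope.
Local Open Scope ring_scope.

Section DirectSum.
Variables (G M : zmodType) (comp : G -> set M).

Definition sum_over (P : set G) : set M :=
  [set x | exists (s : seq G) (c : G -> M),
     [/\ uniq s, forall g, g \in s -> P g, forall g, comp g (c g)
       & x = \sum_(g <- s) c g]].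

Definition is_direct_sum : Prop :=
  [/\ forall g, comp g 0 /\ (forall x y, comp g x -> comp g y -> comp g (x - y)),
      forall x, sum_over setT x
    & forall (s : seq G) (c : G -> M), uniq s -> (forall g, comp g (c g)) ->
        \sum_(g <- s) c g = 0 -> forall g, g \in s -> c g = 0].

Lemma homog_sum h x (s : seq G) (c : G -> M) : is_direct_sum ->
  comp h x -> uniq s -> (forall g, comp g (c g)) -> x = \sum_(g <- s) c g ->
  x = if h \in s then c h else 0.
Proof.
move=> [sub _ ind] hx us cP e.
pose d g := if g == h then (if h \in s then c h else 0) - x else c g.
have dP g : comp g (d g).
  rewrite /d; case: eqP => // ->; case: (sub h) => s0 sB.
  by apply: sB => //; case: ifP.
have [hs|hs] := boolP (h \in s).
  apply/esym/subr0_eq.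
  have := ind s d us dP _ h hs; rewrite /d eqxx hs; apply.
  rewrite (bigD1_seq h) //= eqxx.
  under eq_bigr => g /negPf -> do [].
  by rewrite addrAC -(bigD1_seq h hs us (F := c)) -e subrr.
have uhs : uniq (h :: s) by rewrite /= hs.
have := ind (h :: s) d uhs dP _ h (mem_head _ _).
rewrite /d eqxx (negPf hs) sub0r => H; apply: oppr_inj; rewrite oppr0; apply: H.
rewrite big_cons eqxx (eq_big_seq c) -?e ?addNr // => g gs.
by case: eqP => // gh; rewrite -gh gs in hs.
Qed.

End DirectSum.

Section GradedAlgebra.
Variables (F : fieldType) (G : zmodType) (D : algType F) (comp : G -> set D).

Definition graded_algebra : Prop :=
  [/\ is_direct_sum comp,
      forall g (a : F) x, comp g x -> comp g (a *: x)
    & forall g h x y, comp g x -> comp h y -> comp (g + h) (x * y)].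

(* D is nonzero since 1 != 0 in an algType. *)
Definition graded_division : Prop :=
  graded_algebra /\
  (forall g x, comp g x -> x != 0 -> exists y, x * y = 1 /\ y * x = 1).

Definition support : set G := [set g | exists2 x, comp g x & x != 0].

Lemma graded_one : graded_algebra -> comp 0 1.
Proof.
move=> [dsum _ compM]; have [sub tot _] := dsum.
have [s [c [us _ cP e1]]] := tot 1.
pose e := if 0 \in s then c 0 else 0.
have eP : comp 0 e by rewrite /e; case: ifP => // _; case: (sub 0).
suff xe h x : comp h x -> x = x * e.
  suff -> : 1 = e by [].
  rewrite -[e]mul1r {1 2}e1 mulr_suml.
  by apply: eq_bigr => g _; apply: (xe g).
move=> hx.
rewrite {1}(@homog_sum _ _ comp h x (map (+%R h) s) (fun g => x * c (g - h))) //.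
- rewrite -{1}[h]addr0 (mem_map (addrI h)) subrr /e; case: ifP => // _.
  by rewrite mulr0.
- by rewrite (map_inj_uniq (addrI h)).
- by move=> g; rewrite -{1}[g](subrK h) addrC; apply: compM.
rewrite big_map -{1}[x]mulr1 e1 mulr_sumr; apply: eq_bigr => g _.
by rewrite addrC addKr.
Qed.

Lemma graded_inv x y : graded_algebra -> comp 0 x ->
  x * y = 1 -> y * x = 1 -> comp 0 y.
Proof.
move=> galg x0 xy yx; have [dsum _ compM] := galg; have [_ tot _] := dsum.
have [s [c [us _ cP ey]]] := tot y.
have : 1 = if 0 \in s then x * c 0 else 0.
  apply: (@homog_sum _ _ comp 0 1 s (fun g => x * c g)) => //.
  - exact: graded_one.
  - by move=> g; rewrite -[g]add0r; apply: compM; rewrite ?add0r.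
  - by rewrite -mulr_sumr -ey xy.
case: ifP => _; last by move/eqP; rewrite oner_eq0.
by move=> e; rewrite -[y]mulr1 e mulrA yx mul1r.
Qed.

End GradedAlgebra.

Section IdentityUnits.
Variables (F : fieldType) (G : zmodType) (D : algType F) (comp : G -> set D).

Record identity_units (hD : graded_division comp) : Type := IdentityUnit {
  unit_val : D;
  unit_comp : comp 0 unit_val;
  unit_neq0 : unit_val != 0 }.

Variable hD : graded_division comp.
Local Notation U := (identity_units hD).

HB.instance Definition _ := gen_eqMixin U.
HB.instance Definition _ := gen_choiceMixin U.

Lemma unit_val_inj : injective (@unit_val hD).
Proof.
case=> x xc x0 [y yc y0] /= e; subst y.
by rewrite (Prop_irrelevance xc yc) (Prop_irrelevance x0 y0).
Qed.

Let oneU : U := IdentityUnit hD (graded_one hD.1) (oner_neq0 D).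

Fact mulU_comp (x y : U) : comp 0 (unit_val x * unit_val y).
Proof.
have [[_ _ compM] _] := hD.
by rewrite -[0]addr0; apply: compM; apply: unit_comp.
Qed.

Fact mulU_neq0 (x y : U) : unit_val x * unit_val y != 0.
Proof.
have [z [_ zx]] := hD.2 _ _ (unit_comp x) (unit_neq0 x).
apply/eqP => /(congr1 ( *%R z)); rewrite mulrA zx mul1r mulr0.
exact/eqP/unit_neq0.
Qed.

Let mulU (x y : U) : U := IdentityUnit hD (mulU_comp x y) (mulU_neq0 x y).

Fact invU_ex (x : U) : exists y : U, unit_val x * unit_val y = 1 /\ unit_val y * unit_val x = 1.
Proof.
have [y [xy yx]] := hD.2 _ _ (unit_comp x) (unit_neq0 x).
have y0 : y != 0.
  by apply/eqP => y0; move/eqP: xy; rewrite y0 mulr0 eq_sym oner_eq0.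
by exists (IdentityUnit hD (graded_inv hD.1 (unit_comp x) xy yx) y0).
Qed.

Let invU (x : U) : U := projT1 (cid (invU_ex x)).

Fact mulUA : associative mulU.
Proof. by move=> x y z; apply: unit_val_inj; apply: mulrA. Qed.
Fact mul1U : left_id oneU mulU.
Proof. by move=> x; apply: unit_val_inj; apply: mul1r. Qed.
Fact mulU1 : right_id oneU mulU.
Proof. by move=> x; apply: unit_val_inj; apply: mulr1. Qed.
Fact mulVU : left_inverse oneU invU mulU.
Proof.
by move=> x; apply: unit_val_inj; rewrite /invU; case: cid => y []. Qed.
Fact mulUV : right_inverse oneU invU mulU.
Proof.
by move=> x; apply: unit_val_inj; rewrite /invU; case: cid => y []. Qed.

HB.instance Definition _ := isGroup.Build U mulUA mul1U mulU1 mulVU mulUV.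

End IdentityUnits.

Section Stabilizer.
Variables (F : fieldType) (G : zmodType) (A : algType F) (comp : G -> set A).

Record stabilizer : Type := Stabilizer {
  stab_fun :> {lrmorphism A -> A};
  stab_bij : bijective stab_fun;
  stab_comp : forall g, stab_fun @` comp g = comp g }.

HB.instance Definition _ := gen_eqMixin stabilizer.
HB.instance Definition _ := gen_choiceMixin stabilizer.

Lemma stabP (f g : stabilizer) : f =1 g -> f = g.
Proof.
case: f => [[f [[fa] [fb] [fc]]] fB fC]; case: g => [[g [[ga] [gb] [gc]]] gB gC].
move=> /funext /= e; subst g.
rewrite (Prop_irrelevance ga fa) (Prop_irrelevance gb fb) in gB gC *.
rewrite (Prop_irrelevance gc fc) in gB gC *.
by rewrite (Prop_irrelevance gB fB) (Prop_irrelevance gC fC).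
Qed.

Lemma stab_in (f : stabilizer) g x : comp g x -> comp g (f x).
Proof. by move=> gx; rewrite -(stab_comp f g); exists x. Qed.

Fact stab1_comp g : (idfun : {lrmorphism A -> A}) @` comp g = comp g.
Proof. exact: image_id. Qed.

Let stab1 : stabilizer :=
  @Stabilizer (idfun : {lrmorphism A -> A}) (Bijective (frefl _) (frefl _)) stab1_comp.

Fact stabM_comp (f h : stabilizer) g :
  (f \o h : {lrmorphism A -> A}) @` comp g = comp g.
Proof. by rewrite /= -image_comp !stab_comp. Qed.

Let stabM (f h : stabilizer) : stabilizer :=
  @Stabilizer (f \o h : {lrmorphism A -> A})
    (bij_comp (stab_bij f) (stab_bij h)) (stabM_comp f h).

Fact stabV_ex (f : stabilizer) :
  exists h : stabilizer, cancel f h /\ cancel h f.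
Proof.
case: (stab_bij f) => h fK hK.
pose h1 := GRing.isLinear.Build F A A _ h (can2_linear fK hK).
pose h2 := GRing.isMonoidMorphism.Build A A h (can2_monoid_morphism fK hK).
pose hl : {lrmorphism A -> A} :=
  HB.pack_for {lrmorphism A -> A} h h1 h2.
have hc g : hl @` comp g = comp g.
  rewrite -{1}(stab_comp f g) image_comp -[RHS]image_id.
  by congr image; apply/funext => x; exact: fK.
by exists (@Stabilizer hl (Bijective hK fK) hc).
Qed.

Let stabV (f : stabilizer) : stabilizer := projT1 (cid (stabV_ex f)).

Fact stabMA : associative stabM.
Proof. by move=> f g h; apply: stabP. Qed.
Fact stab1M : left_id stab1 stabM.
Proof. by move=> f; apply: stabP. Qed.
Fact stabM1 : right_id stab1 stabM.
Proof. by move=> f; apply: stabP. Qed.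
Fact stabVM : left_inverse stab1 stabV stabM.
Proof. by move=> f; apply: stabP => x; rewrite /stabV /=; case: cid => h [/= fK _]; exact: fK. Qed.
Fact stabMV : right_inverse stab1 stabV stabM.
Proof. by move=> f; apply: stabP => x; rewrite /stabV /=; case: cid => h [/= _ hK]; exact: hK. Qed.

HB.instance Definition _ := isGroup.Build stabilizer stabMA stab1M stabM1 stabVM stabMV.

End Stabilizer.

Section SemidirectProduct.
Local Open Scope group_scope.
Variables N H : groupType.

Record group_action : Type := GroupAction {
  gact :> H -> N -> N;
  gact1 : forall n, gact 1 n = n;
  gactM : forall h k n, gact (h * k) n = gact h (gact k n);
  gact_morph : forall h m n, gact h (m * n) = gact h m * gact h n }.

Variable act : group_action.

(* N ><| H, with (m, h) (n, k) = (m * act h n, h * k). *)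
Record semidirect (a : group_action) : Type :=
  Semidirect { sd_left : N; sd_right : H }.

Local Notation S := (semidirect act).

HB.instance Definition _ := gen_eqMixin S.
HB.instance Definition _ := gen_choiceMixin S.

Let oneS : S := Semidirect act 1 1.
Let mulS (x y : S) : S :=
  Semidirect act (sd_left x * act (sd_right x) (sd_left y)) (sd_right x * sd_right y).
Let invS (x : S) : S :=
  Semidirect act (act (sd_right x)^-1 (sd_left x)^-1) (sd_right x)^-1.

Fact gact_one h : act h 1 = 1.
Proof. by apply: (mulgI (act h 1)); rewrite -gact_morph !mulg1. Qed.

Fact mulSA : associative mulS.
Proof. by move=> x y z; rewrite /mulS /= gact_morph gactM !mulgA. Qed.
Fact mul1S : left_id oneS mulS.
Proof. by case=> n h; rewrite /mulS /= gact1 !mul1g. Qed.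
Fact mulS1 : right_id oneS mulS.
Proof. by case=> n h; rewrite /mulS /= gact_one !mulg1. Qed.
Fact mulVS : left_inverse oneS invS mulS.
Proof. by case=> n h; rewrite /mulS /= -gact_morph !mulVg gact_one. Qed.
Fact mulSV : right_inverse oneS invS mulS.
Proof. by case=> n h; rewrite /mulS /= -gactM !mulgV gact1 mulgV. Qed.

HB.instance Definition _ := isGroup.Build S mulSA mul1S mulS1 mulVS mulSV.

End SemidirectProduct.

Section ComponentwiseAction.
Variables (F : fieldType) (G : zmodType) (D : algType F) (comp : G -> set D).
Variables (hD : graded_division comp) (n : nat).
Local Notation U := (identity_units hD).

Fact stab_unit_neq0 (f : stabilizer comp) (x : U) : f (unit_val x) != 0.
Proof.
by rewrite -(rmorph0 f) (inj_eq (bij_inj (stab_bij f))) unit_neq0.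
Qed.

Definition stab_unit (f : stabilizer comp) (x : U) : U :=
  IdentityUnit hD (stab_in f (unit_comp x)) (stab_unit_neq0 f x).

Let act (f : stabilizer comp) (x : {ffun 'I_n -> U}) : {ffun 'I_n -> U} :=
  [ffun i => stab_unit f (x i)].

Fact act1 x : act 1%g x = x.
Proof. by apply/ffunP => i; rewrite ffunE; apply: unit_val_inj. Qed.
Fact actM f g x : act (f * g)%g x = act f (act g x).
Proof. by apply/ffunP => i; rewrite !ffunE; apply: unit_val_inj. Qed.
Fact act_morph f x y : act f (x * y)%g = (act f x * act f y)%g.
Proof.
by apply/ffunP => i; rewrite !ffunE; apply: unit_val_inj; apply: rmorphM.
Qed.

Definition componentwise_action :
    group_action {ffun 'I_n -> U} (stabilizer comp) :=
  GroupAction act1 actM act_morph.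

End ComponentwiseAction.

Section EndomorphismAlgebra.
Variables (F : fieldType) (D : algType F) (V : lmodType D^c).

(* The nonzeroness of V is a parameter because an algType satisfies 1 != 0. *)
Definition endD (V0 : exists v : V, v != 0) : Type := {linear V -> V}.

Variable V0 : exists v : V, v != 0.
Local Notation R := (endD V0).

HB.instance Definition _ := gen_eqMixin R.
HB.instance Definition _ := gen_choiceMixin R.

Definition endD_fun (r : R) : {linear V -> V} := r.
Coercion endD_fun : endD >-> GRing.Linear.type.

Lemma endDP (r s : R) : r =1 s -> r = s.
Proof.
case: r => r [[ra] [rb]]; case: s => s [[sa] [sb]] /funext /= e; subst s.
by rewrite (Prop_irrelevance ra sa) (Prop_irrelevance rb sb).
Qed.

Let zeroR : R := \0 : {linear V -> V}.
Let addR (r s : R) : R := (r \+ s : {linear V -> V}).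
Let oppR (r : R) : R := (\- r : {linear V -> V}).
Let oneR : R := (idfun : {linear V -> V}).
Let mulR (r s : R) : R := (r \o s : {linear V -> V}).

Definition scaleR_fun (a : F) (r : R) (v : V) : V := (a%:A : D^c) *: r v.

Fact scaleR_linear a r : linear (scaleR_fun a r).
Proof.
move=> d u v; rewrite /scaleR_fun linearP scalerDr !scalerA; congr (_ *: _ + _).
by change (@GRing.mul D d a%:A = @GRing.mul D a%:A d); rewrite mulr_algr mulr_algl.
Qed.

HB.instance Definition _ a r :=
  GRing.isLinear.Build D^c V V _ (scaleR_fun a r) (scaleR_linear a r).

Let scaleR (a : F) (r : R) : R := (scaleR_fun a r : {linear V -> V}).

Fact addRA : associative addR.
Proof. by move=> r s t; apply: endDP => v; apply: addrA. Qed.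
Fact addRC : commutative addR.
Proof. by move=> r s; apply: endDP => v; apply: addrC. Qed.
Fact add0R : left_id zeroR addR.
Proof. by move=> r; apply: endDP => v; apply: add0r. Qed.
Fact addNR : left_inverse zeroR oppR addR.
Proof. by move=> r; apply: endDP => v; apply: addNr. Qed.

HB.instance Definition _ := GRing.isZmodule.Build R addRA addRC add0R addNR.

Fact mulRA : associative mulR.
Proof. by move=> r s t; apply: endDP. Qed.
Fact mul1R : left_id oneR mulR.
Proof. by move=> r; apply: endDP. Qed.
Fact mulR1 : right_id oneR mulR.
Proof. by move=> r; apply: endDP. Qed.
Fact mulRDl : left_distributive mulR +%R.
Proof. by move=> r s t; apply: endDP. Qed.
Fact mulRDr : right_distributive mulR +%R.
Proof. by move=> r s t; apply: endDP => v; apply: linearD. Qed.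
Fact oneR_neq0 : oneR != 0.
Proof.
case: V0 => v v0; apply/eqP => /(congr1 (fun r : R => r v)) e.
by move/eqP: v0; apply.
Qed.

HB.instance Definition _ :=
  GRing.Zmodule_isNzRing.Build R mulRA mul1R mulR1 mulRDl mulRDr oneR_neq0.

Fact scaleRA a b r : scaleR a (scaleR b r) = scaleR (a * b) r.
Proof.
apply: endDP => v; rewrite /= /scaleR_fun /= /scaleR_fun scalerA.
congr (_ *: _); change (@GRing.mul D b%:A a%:A = (a * b)%:A).
by rewrite mulr_algl scalerA mulrC.
Qed.
Fact scale1R : left_id 1 scaleR.
Proof. by move=> r; apply: endDP => v; rewrite /= /scaleR_fun !scale1r. Qed.
Fact scaleRDr : right_distributive scaleR +%R.
Proof. by move=> a r s; apply: endDP => v; apply: scalerDr. Qed.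
Fact scaleRDl r : {morph scaleR^~ r : a b / a + b}.
Proof.
move=> a b; apply: endDP => v; rewrite /= /scaleR_fun.
by rewrite [(a + b)%:A]scalerDl; apply: scalerDl.
Qed.

HB.instance Definition _ :=
  GRing.Zmodule_isLmodule.Build F R scaleRA scale1R scaleRDr scaleRDl.

Fact scaleRAl a (r s : R) : a *: (r * s) = (a *: r) * s.
Proof. exact: endDP. Qed.

HB.instance Definition _ := GRing.Lmodule_isLalgebra.Build F R scaleRAl.

Fact scaleRAr a (r s : R) : a *: (r * s) = r * (a *: s).
Proof. by apply: endDP => v; rewrite /= /scaleR_fun linearZ. Qed.

HB.instance Definition _ := GRing.Lalgebra_isAlgebra.Build F R scaleRAr.

End EndomorphismAlgebra.

Section GradedModule.
Variables (F : fieldType) (G : zmodType) (D : algType F) (compD : G -> set D).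
Variables (V : lmodType D^c) (compV : G -> set V).

(* Each component is automatically an F-subspace, as F 1 lies in D_e. *)
Definition graded_module : Prop :=
  is_direct_sum compV /\
  (forall g h (v : V) (d : D), compV g v -> compD h d ->
     compV (g + h) ((d : D^c) *: v)).

(* W has D-dimension n: it has a homogeneous D-basis of cardinality n. *)
Definition has_dim (W : set V) (n : nat) : Prop :=
  exists b : 'I_n -> V,
    [/\ forall i, W (b i) /\ (exists g, compV g (b i)),
        forall w, W w -> exists d : 'I_n -> D, w = \sum_i (d i : D^c) *: b i
      & forall d : 'I_n -> D, \sum_i (d i : D^c) *: b i = 0 -> forall i, d i = 0].

Definition coset_component (g : G) : set V :=
  sum_over compV [set h | support compD (h - g)].

(* g_1 T, ..., g_s T are the distinct supports of the isotypic components. *)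
Definition isotypic_supports (s : nat) (g : 'I_s -> G) : Prop :=
  (forall i j, support compD (g i - g j) -> i = j) /\
  (forall h, coset_component h <> [set 0] <-> exists i, support compD (h - g i)).

Definition fine_condition : Prop :=
  exists (s : nat) (g : 'I_s -> G) (k : 'I_s -> nat),
    [/\ isotypic_supports g,
        forall i, has_dim (coset_component (g i)) (k i),
        forall i, k i = 1%N
      & forall i j h l, i != j -> (i, j) != (h, l) ->
          ~ support compD ((g i - g j) - (g h - g l))].

Definition end_comp (V0 : exists v : V, v != 0) (g : G) : set (endD V0) :=
  [set r | forall h v, compV h v -> compV (g + h) (r v)].

End GradedModule.

Arguments end_comp {F G D V} compV V0 g.

(* Main.v *)
(* The fine condition makes the degrees h_i of any homogeneous D-basis (b_i) of
   V distinct modulo T with pairwise distinct differences.  A pair (x, f), with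
   x a family of units of D_e (and x_0 = 1) and f in Stab(Gamma_0), gives the
   f-semilinear, degree-preserving bijection of V
     twist : sum_i b_i d_i |-> sum_i b_i x_i f(d_i),
   and conjugation by it is an element of Stab(Gamma).  This is an injective
   morphism; it is onto because psi in Stab(Gamma) is the conjugation by
   v |-> psi(E_v)(b_0), where E_v sends b_0 to v and the other b_i to 0.  By the
   fine condition psi maps the matrix units E_ij (i <> j) to b_j |-> b_i u, with
   u in D_e, which forces this map to be a twist. *)
Require Import Defs.
From HB Require Import structures.
From mathcomp Require Import all_boot all_order all_algebra.
From mathcomp Require Import boolp classical_sets.

Set Implicit Arguments.
Unset Strict Implicit.
Unset Printing Implicit Defensive.

Import GRing.Theory.
Local Open Scope classical_set_scope.
Local Open Scope ring_scope.

Lemma subrACA (M : zmodType) (x y z t : M) :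
  (x - y) - (z - t) = (x - z) - (y - t).
Proof. by rewrite !opprB [t - z]addrC addrACA [- y + t]addrC. Qed.

(** * The right action of [D] on [V] *)

Section RightAction.
Variables (F : fieldType) (D : algType F) (V : lmodType D^c).

(** Scalars are typed in [D], so that products of scalars, as in [ractA], are taken in [D] and not
    in its converse. *)
Definition ract (v : V) (d : D) : V := (d : D^c) *: v.
Local Notation "v ** d" := (ract v d) (at level 40, left associativity).

Lemma ract0 v : v ** 0 = 0. Proof. exact: scale0r. Qed.
Lemma ract1 v : v ** 1 = v. Proof. exact: scale1r. Qed.
Lemma ractDr v d e : v ** (d + e) = v ** d + v ** e.
Proof. exact: scalerDl. Qed.
Lemma ractBr v d e : v ** (d - e) = v ** d - v ** e.
Proof. exact: scalerBl. Qed.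
Lemma ractDl u v d : (u + v) ** d = u ** d + v ** d.
Proof. exact: scalerDr. Qed.
Lemma ractA v d e : v ** d ** e = v ** (d * e). Proof. exact: scalerA. Qed.
Lemma ract_sumr I (s : seq I) (P : pred I) v (d : I -> D) :
  v ** (\sum_(i <- s | P i) d i) = \sum_(i <- s | P i) v ** d i.
Proof. exact: scaler_suml. Qed.
Lemma ract_suml I (s : seq I) (P : pred I) (v : I -> V) d :
  (\sum_(i <- s | P i) v i) ** d = \sum_(i <- s | P i) v i ** d.
Proof. exact: scaler_sumr. Qed.
Lemma linear_ract (r : {linear V -> V}) v d : r (v ** d) = r v ** d.
Proof. exact: linearZ. Qed.

End RightAction.

Local Notation "v ** d" := (ract v d) (at level 40, left associativity).

(** * Homogeneous components in a direct sum *)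

Section DirectSum.
Variables (G M : zmodType) (comp : G -> set M).
Hypothesis dsum : is_direct_sum comp.

Lemma comp0 g : comp g 0.
Proof. by case: dsum => /(_ g)[]. Qed.

Lemma compB g x y : comp g x -> comp g y -> comp g (x - y).
Proof. by case: dsum => /(_ g)[_ cB] _ _; apply: cB. Qed.

Lemma compD g x y : comp g x -> comp g y -> comp g (x + y).
Proof.
move=> xg yg; rewrite -[y]opprK -[- y]sub0r.
by apply: compB => //; apply: compB => //; apply: comp0.
Qed.

Lemma comp_sum I (s : seq I) (P : pred I) g (x : I -> M) :
  (forall i, P i -> comp g (x i)) -> comp g (\sum_(i <- s | P i) x i).
Proof.
move=> xP; elim/big_ind: _ => //; first exact: comp0.
by move=> u v; apply: compD.
Qed.

(** The family is made to vanish outside [s], so that the index set can later be enlarged without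
    changing the sum. *)
Lemma decomp x : exists (s : seq G) (c : G -> M),
  [/\ uniq s, forall g, comp g (c g), forall g, g \notin s -> c g = 0
    & x = \sum_(g <- s) c g].
Proof.
case: dsum => _ /(_ x)[s [c [us _ cP ->]]] _.
exists s, (fun g => if g \in s then c g else 0); split => //.
- by move=> g; case: ifP => // _; apply: comp0.
- by move=> g /negPf->.
by apply: eq_big_seq => g ->.
Qed.

Lemma direct_sum_ind (P : M -> Prop) : P 0 ->
  (forall x y, P x -> P y -> P (x + y)) -> (forall g x, comp g x -> P x) ->
  forall x, P x.
Proof.
move=> P0 PD Ph x; have [s [c [_ cP _ ->]]] := decomp x.
by elim/big_ind: _ => // g _; apply: Ph (cP g).
Qed.

End DirectSum.

(** * The support [T] is a subgroup *)

Section Support.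
Variables (F : fieldType) (G : zmodType) (D : algType F) (comp : G -> set D).
Hypothesis hD : graded_division comp.

Lemma support0 : Defs.support comp 0.
Proof. by exists 1; [apply: graded_one hD.1 | apply: oner_neq0]. Qed.

Lemma supportD g h :
  Defs.support comp g -> Defs.support comp h -> Defs.support comp (g + h).
Proof.
move=> [x xg x0] [y yh y0]; have [[_ _ compM] inv] := hD.
exists (x * y); first exact: compM.
have [z [_ zx]] := inv _ _ xg x0.
by apply: contra_neq y0 => xy0; rewrite -[y]mul1r -zx -mulrA xy0 mulr0.
Qed.

(** The inverse [y] of [x] is not assumed homogeneous; the component of degree 0 in [x * y = 1]
    shows that the component of [y] of degree [- g] is nonzero. *)
Lemma supportN g : Defs.support comp g -> Defs.support comp (- g).
Proof.
move=> [x xg x0]; have [[dsum _ compM] inv] := hD.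
have [y [xy _]] := inv _ _ xg x0.
have [s [c [us cP _ ey]]] := decomp dsum y.
have e1 : 1 = if 0 \in map (+%R g) s then x * c (0 - g) else 0.
  apply: (homog_sum (c := fun h => x * c (h - g)) dsum (graded_one hD.1)).
  - by rewrite (map_inj_uniq (addrI g)).
  - by move=> h; rewrite -{1}[h](subrK g) addrC; apply: compM.
  rewrite big_map -xy ey mulr_sumr; apply: eq_bigr => h _.
  by rewrite addrC addKr.
exists (c (- g)) => //; move: e1; case: ifP => _ e1.
  by apply: contra_eq_neq e1; rewrite sub0r => ->; rewrite mulr0 oner_neq0.
by move/eqP: e1; rewrite oner_eq0.
Qed.

Lemma supportB g h :
  Defs.support comp g -> Defs.support comp h -> Defs.support comp (g - h).
Proof. by move=> gT /supportN; apply: supportD. Qed.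

End Support.

(** * Coefficients of homogeneous vectors *)

Section HomogeneousBasis.
Variables (F : fieldType) (G : zmodType) (D : algType F) (compD : G -> set D).
Variables (V : lmodType D^c) (compV : G -> set V).
Hypotheses (dsumD : is_direct_sum compD) (hV : graded_module compD compV).
Variables (n : nat) (b : 'I_n -> V) (h : 'I_n -> G).
Hypothesis bh : forall i, compV (h i) (b i).
Hypothesis bfree :
  forall d : 'I_n -> D, \sum_i b i ** d i = 0 -> forall i, d i = 0.

(** As [b i] has degree [h i], the part of degree [g] of the sum involves only the components of
    [d i] of degree [g - h i]; freeness identifies [d i] with that component. *)
Lemma homogeneous_coef g (d : 'I_n -> D) :
  compV g (\sum_i b i ** d i) -> forall i, compD (g - h i) (d i).
Proof.
have [dsumV compVM] := hV => wg.
have /cid[s /cid[c hc]] : exists (s : 'I_n -> seq G) (c : 'I_n -> G -> D),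
      forall i, [/\ uniq (s i), forall t, compD t (c i t),
      forall t, t \notin s i -> c i t = 0 & d i = \sum_(t <- s i) c i t].
  have /choice[s hs] := fun i => decomp dsumD (d i).
  by have /choice[c hc] := hs; exists s, c.
(* All degrees [t + h i] that occur, so that one index set serves every [i]. *)
pose S := undup (flatten [seq [seq t + h i | t <- s i] | i <- enum 'I_n]).
have us : uniq S by rewrite undup_uniq.
have dE i : d i = \sum_(t <- S) c i (t - h i).
  case: (hc i) => ui _ c0 ->.
  rewrite -[RHS](big_rmcond _ _ (P := fun t => t - h i \in s i)) => [|t];
    last exact: c0.
  rewrite -[RHS]big_filter [RHS](perm_big [seq t + h i | t <- s i]) /=.
    by rewrite big_map; apply: eq_bigr => t _; rewrite addrK.
  apply: uniq_perm; rewrite ?filter_uniq ?(map_inj_uniq (addIr _)) // => t.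
  have tE : (t \in [seq t + h i | t <- s i]) = (t - h i \in s i).
    by rewrite -{1}[t](subrK (h i)) (mem_map (addIr _)).
  rewrite mem_filter -tE andb_idr // => ti; rewrite mem_undup.
  apply/flattenP; exists [seq t + h i | t <- s i] => //.
  by apply: (map_f (fun i => [seq t + h i | t <- s i])); rewrite mem_enum.
have cE : \sum_i b i ** d i = \sum_(t <- S) \sum_i b i ** c i (t - h i).
  rewrite exchange_big; apply: eq_bigr => i _.
  by rewrite [in LHS]dE ract_sumr.
have wE := homog_sum dsumV wg us _ cE.
pose d' i := if g \in S then c i (g - h i) else 0.
have d'P i : compD (g - h i) (d' i).
  by rewrite /d'; case: ifP => _; [case: (hc i) | apply: comp0].
suff dd' i : d i = d' i by move=> i; rewrite dd'.
apply/subr0_eq; apply: (bfree (d := fun i => d i - d' i)).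
under eq_bigr do rewrite ractBr.
rewrite sumrB wE.
- rewrite /d'; case: ifP => _; first by rewrite subrr.
  by rewrite big1 ?subrr // => j _; rewrite ract0.
- move=> t; apply: comp_sum => // j _.
  have [_ cP _ _] := hc j.
  by have := compVM _ _ _ _ (bh j) (cP (t - h j)); rewrite addrC subrK.
Qed.

End HomogeneousBasis.

(** * The fine condition in terms of a homogeneous basis *)

Section FineBasis.
Variables (F : fieldType) (G : zmodType) (D : algType F) (compD : G -> set D).
Variables (V : lmodType D^c) (compV : G -> set V).
Hypotheses (hD : graded_division compD) (hV : graded_module compD compV).
Local Notation T := (Defs.support compD).

Variables (n : nat) (b : 'I_n -> V) (h : 'I_n -> G).
Hypothesis bh : forall i, compV (h i) (b i).
Hypothesis bfree :
  forall d : 'I_n -> D, \sum_i b i ** d i = 0 -> forall i, d i = 0.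

Lemma free_pair i j x y : i != j -> b i ** x + b j ** y = 0 -> y = 0.
Proof.
move=> ij e; pose d l := if l == i then x else if l == j then y else 0.
have := bfree (d := d) _ j; rewrite {2}/d [j == i]eq_sym (negPf ij) eqxx.
apply; rewrite (bigD1 i) // (bigD1 j) /=; last by rewrite eq_sym.
rewrite big1 => [|l /andP[li lj]].
  by rewrite addr0 /d eqxx [j == i]eq_sym (negPf ij) eqxx.
by rewrite /d (negPf li) (negPf lj) ract0.
Qed.

Lemma free_neq0 i : b i != 0.
Proof.
apply/eqP => bi0; have /negP[] := oner_neq0 D; apply/eqP.
pose d l : D := (l == i)%:R.
have := bfree (d := d) _ i; rewrite {2}/d eqxx; apply.
rewrite big1 // => j _; rewrite /d; case: eqP => [->|_]; last exact: ract0.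
by rewrite bi0 ract1.
Qed.

Lemma cosetP g l v : compV g v -> T (g - l) -> coset_component compD compV l v.
Proof.
move=> vg gl; exists [:: g], (fun g' => if g' == g then v else 0).
split => //.
- by move=> g'; rewrite inE => /eqP->.
- by move=> g'; case: eqP => [->|_] //; apply: comp0 hV.1 _.
by rewrite big_seq1 eqxx.
Qed.

(** Both [b i] and [b j] are multiples of the single generator of the component, by nonzero
    homogeneous and hence invertible coefficients. They would be proportional, against freeness. *)
Lemma coset_dim1 l i j : has_dim compV (coset_component compD compV l) 1 ->
  T (h i - l) -> T (h j - l) -> i = j.
Proof.
move=> [c [cP cspan cfree]] il jl; apply/eqP/negPn/negP => ij.
have [_ [gc cg]] := cP ord0.
have coef k : T (h k - l) -> exists x y, b k = c ord0 ** x /\ b k ** y = c ord0.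
  move=> kl; have [d dE] := cspan _ (cosetP (bh k) kl).
  have dE1 : b k = c ord0 ** d ord0 by rewrite dE big_ord1.
  have d0 : compD (h k - gc) (d ord0).
    have [[dsumD _ _] _] := hD.
    apply: (homogeneous_coef dsumD hV (b := c) (h := fun=> gc) _ _ (d := d)).
    - by move=> k'; rewrite ord1.
    - exact: cfree.
    - by rewrite -dE.
  have dn0 : d ord0 != 0.
    by apply: contra_neq (free_neq0 k) => d00; rewrite dE1 d00 ract0.
  have [y [xy _]] := hD.2 _ _ d0 dn0.
  by exists (d ord0), y; rewrite dE1 ractA xy ract1.
have [_ [y [_ yE]]] := coef i il.
have [x [_ [xE _]]] := coef j jl.
have /negP[] := oner_neq0 D; rewrite -oppr_eq0; apply/eqP.
apply: (free_pair (x := y * x) ij).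
by rewrite -ractA yE -xE /ract scaleNr scale1r subrr.
Qed.

(** Each [h p] lies in the coset of some [g (f p)], because its isotypic component contains [b p].
    The map [f] is injective by [coset_dim1], and differences of the [h p] agree modulo [T] with
    those of the [g (f p)]. *)
Lemma fine_basis (hfine : fine_condition compD compV) i j m l :
  i != j -> (i, j) != (m, l) -> ~ T (h i - h j - (h m - h l)).
Proof.
move=> ij ijml hT; have [s [g [k [[_ gE] gdim k1 gfine]]]] := hfine.
have /choice[f fP] p : exists q, T (h p - g q).
  apply/gE => e; have := cosetP (bh p) (l := h p).
  rewrite e subrr => /(_ (support0 hD)) /= bp0.
  by move/eqP: (free_neq0 p); apply.
have f_inj : injective f.
  move=> p q pq; apply: (@coset_dim1 (g (f p))) => //; last by rewrite pq.
  by rewrite -(k1 (f p)).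
apply: (gfine (f i) (f j) (f m) (f l)).
- by rewrite (inj_eq f_inj).
- by apply: contra_neq ijml => -[/f_inj-> /f_inj->].
have gB p q : g (f p) - g (f q)
    = (h p - h q) - ((h p - g (f p)) - (h q - g (f q))).
  by rewrite subrACA; congr (_ - _); rewrite opprB addrC subrK.
by rewrite !gB subrACA; do ![apply: supportB => //].
Qed.

End FineBasis.

(** * Coordinates, maps of rank one and semilinear twists *)

Section Twist.
Variables (F : fieldType) (G : zmodType) (D : algType F) (compD : G -> set D).
Variables (V : lmodType D^c) (compV : G -> set V) (V0 : exists v : V, v != 0).
Hypotheses (hD : graded_division compD) (hV : graded_module compD compV).
Local Notation T := (Defs.support compD).
Local Notation U := (identity_units hD).
Local Notation R := (endD V0).

Variables (n : nat) (b : 'I_n.+1 -> V) (h : 'I_n.+1 -> G).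
Hypothesis bh : forall i, compV (h i) (b i).
Hypothesis bspan : forall v, exists d : 'I_n.+1 -> D, v = \sum_i b i ** d i.
Hypothesis bfree :
  forall d : 'I_n.+1 -> D, \sum_i b i ** d i = 0 -> forall i, d i = 0.

Local Notation S := (semidirect (componentwise_action hD n)).

Let dsumD : is_direct_sum compD. Proof. by case: hD => -[]. Qed.
Let compDM g l x y : compD g x -> compD l y -> compD (g + l) (x * y).
Proof. by case: hD => -[_ _ cM] _; apply: cM. Qed.
Let dsumV : is_direct_sum compV := hV.1.
Let compVM g l v d : compV g v -> compD l d -> compV (g + l) (v ** d) :=
  @hV.2 g l v d.

Definition coord (v : V) : 'I_n.+1 -> D := projT1 (cid (bspan v)).

Lemma coordE v : v = \sum_i b i ** coord v i.
Proof. by rewrite /coord; case: cid. Qed.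

Lemma coord_eq v d : v = \sum_i b i ** d i -> forall i, coord v i = d i.
Proof.
move=> e i; apply/subr0_eq; apply: (bfree (d := fun i => coord v i - d i)).
under eq_bigr do rewrite ractBr.
by rewrite sumrB -coordE -e subrr.
Qed.

Lemma coordD u v i : coord (u + v) i = coord u i + coord v i.
Proof.
apply: (coord_eq (d := fun i => coord u i + coord v i)).
by under eq_bigr do rewrite ractDr; rewrite big_split -!coordE.
Qed.

Lemma coord_ract v d i : coord (v ** d) i = coord v i * d.
Proof.
apply: (coord_eq (d := fun i => coord v i * d)).
by under eq_bigr do rewrite -ractA; rewrite -ract_suml -coordE.
Qed.

Lemma coord_basis i j : coord (b i) j = (j == i)%:R.
Proof.
apply: (coord_eq (d := fun j => (j == i)%:R)).
rewrite (bigD1 i) //= eqxx ract1 big1 ?addr0 // => l /negPf->.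
by rewrite ract0.
Qed.

Lemma coord0 i : coord 0 i = 0.
Proof. by rewrite -(ract0 0) coord_ract mulr0. Qed.

Lemma coord_comp g v i : compV g v -> compD (g - h i) (coord v i).
Proof.
rewrite {1}[v]coordE => /(homogeneous_coef dsumD hV bh bfree).
exact.
Qed.

(** For [v = b i] this is the matrix unit E_ij. *)
Definition rank1_fun (v : V) j (w : V) : V := v ** coord w j.

Fact rank1_linear v j : linear (rank1_fun v j).
Proof.
move=> d u w; rewrite /rank1_fun coordD -/(ract u d) coord_ract ractDr.
by rewrite -ractA.
Qed.

HB.instance Definition _ v j :=
  GRing.isLinear.Build D^c V V _ (rank1_fun v j) (rank1_linear v j).

Definition rank1 v j : R := (rank1_fun v j : {linear V -> V}).

Lemma rank1E v j w : rank1 v j w = v ** coord w j. Proof. by []. Qed.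

Lemma rank1_basis v i j : rank1 v j (b i) = if j == i then v else 0.
Proof. by rewrite rank1E coord_basis; case: eqP; rewrite (ract1, ract0). Qed.

Lemma mul_rank1 (r : R) v j : r * rank1 v j = rank1 (r v) j.
Proof. by apply: endDP => w; rewrite rank1E -linear_ract. Qed.

Lemma rank1D u v j : rank1 (u + v) j = rank1 u j + rank1 v j.
Proof. by apply: endDP => w; rewrite rank1E ractDl. Qed.

Lemma scale_rank1 (a : F) v j : a *: rank1 v j = rank1 (v ** a%:A) j.
Proof.
apply: endDP => w; change (rank1 v j w ** a%:A = rank1 (v ** a%:A) j w).
by rewrite !rank1E !ractA mulr_algl mulr_algr.
Qed.

Lemma rank1_comp g v j : compV g v -> end_comp compV V0 (g - h j) (rank1 v j).
Proof.
move=> vg l w wl; rewrite rank1E.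
by have := compVM vg (coord_comp j wl); rewrite addrCA addrC.
Qed.

Lemma endD_basis (r s : R) : (forall i, r (b i) = s (b i)) -> r = s.
Proof.
move=> rs; apply: endDP => v; rewrite [v]coordE !linear_sum.
by apply: eq_bigr => i _; rewrite !linear_ract rs.
Qed.

(** Right multiplication of [V] by a unit of [D] commutes with every endomorphism, so conjugation by
    it is trivial. Normalizing the factor at index 0 to 1 removes this ambiguity and leaves [n]
    units. *)
Definition scal (x : {ffun 'I_n -> U}) i : D :=
  if unlift ord0 i is Some j then unit_val (x j) else 1.

Definition twist (s : S) (v : V) : V :=
  \sum_i b i ** (scal (sd_left s) i * sd_right s (coord v i)).

Lemma scal_comp x i : compD 0 (scal x i).
Proof.
rewrite /scal; case: unliftP => [j _|_]; first exact: unit_comp.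
exact: graded_one hD.1.
Qed.

Lemma coord_twist s v i :
  coord (twist s v) i = scal (sd_left s) i * sd_right s (coord v i).
Proof. exact: (coord_eq (d := fun i => _ * sd_right s (coord v i))). Qed.

Lemma eq_coord u v : coord u =1 coord v -> u = v.
Proof.
by move=> uv; rewrite [u]coordE [v]coordE; apply: eq_bigr => i _; rewrite uv.
Qed.

Lemma twistD s u v : twist s (u + v) = twist s u + twist s v.
Proof.
by apply: eq_coord => i; rewrite !(coordD, coord_twist) rmorphD mulrDr.
Qed.

Lemma twist_ract s v d : twist s (v ** d) = twist s v ** sd_right s d.
Proof.
by apply: eq_coord => i; rewrite !(coord_ract, coord_twist) rmorphM mulrA.
Qed.

Lemma twist_basis s i : twist s (b i) = b i ** scal (sd_left s) i.
Proof.
apply: eq_coord => j; rewrite coord_ract coord_twist coord_basis.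
case: eqP => [->|_]; first by rewrite rmorph1 mulr1 mul1r.
by rewrite rmorph0 mulr0 mul0r.
Qed.

Lemma twist1 v : twist 1%g v = v.
Proof.
apply: eq_coord => i; rewrite coord_twist /scal.
by case: unliftP => [j _|_]; rewrite /= ?ffunE mul1r.
Qed.

(** With f and y the automorphism of [s] and the units of [t], f moves past y_i as f(y_i): this is
    the componentwise action in the semidirect product. At index 0 it reads f(1) = 1. *)
Lemma twistM s t v : twist (s * t)%g v = twist s (twist t v).
Proof.
apply: eq_coord => i; rewrite !coord_twist rmorphM mulrA /scal.
by case: unliftP => [j _|_]; rewrite /= ?ffunE //= rmorph1 !mul1r.
Qed.

Lemma twistK s : cancel (twist s) (twist s^-1%g).
Proof. by move=> v; rewrite -twistM mulVg twist1. Qed.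

Lemma twistVK s : cancel (twist s^-1%g) (twist s).
Proof. by move=> v; rewrite -twistM mulgV twist1. Qed.

Lemma twist_comp s g v : compV g v -> compV g (twist s v).
Proof.
move=> vg; apply: comp_sum => // i _.
have cg := stab_in (sd_right s) (coord_comp i vg).
have := compVM (bh i) (compDM (scal_comp (sd_left s) i) cg).
by rewrite add0r addrC subrK.
Qed.

(** * Conjugation by twists *)

Definition conj_fun s (r : R) (v : V) : V := twist s (r (twist s^-1%g v)).

Fact conj_linear s r : linear (conj_fun s r).
Proof.
move=> d u v; rewrite /conj_fun twistD -/(ract u d) twist_ract linearD.
rewrite linear_ract twistD twist_ract; congr (_ ** _ + _).
(* The scalar passes through the inverse automorphism and then the automorphism itself. *)
by have := congr1 (fun f : stabilizer compD => f d) (mulgV (sd_right s)).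
Qed.

HB.instance Definition _ s r :=
  GRing.isLinear.Build D^c V V _ (conj_fun s r) (conj_linear s r).

Definition conjR s (r : R) : R := (conj_fun s r : {linear V -> V}).

Lemma conjRE s r v : conjR s r v = twist s (r (twist s^-1%g v)).
Proof. by []. Qed.

Fact conjR_linear s : linear (conjR s).
Proof.
move=> a q r; apply: endDP => v; rewrite conjRE /= twistD; congr (_ + _).
rewrite /scaleR_fun -/(ract _ _) twist_ract; congr (_ ** _).
(* An automorphism of the [F]-algebra [D] fixes [a%:A]. *)
by rewrite linearZ rmorph1.
Qed.

Fact conjR_monoid s : monoid_morphism (conjR s).
Proof.
split=> [|q r]; apply: endDP => v; rewrite conjRE /=; first exact: twistVK.
by rewrite !conjRE twistK.
Qed.

HB.instance Definition _ s :=
  GRing.isLinear.Build F R R _ (conjR s) (conjR_linear s).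
HB.instance Definition _ s :=
  GRing.isMonoidMorphism.Build R R (conjR s) (conjR_monoid s).

Lemma conjR_comp s g r :
  end_comp compV V0 g r -> end_comp compV V0 g (conjR s r).
Proof. by move=> rg l v vl; apply/twist_comp/rg/twist_comp. Qed.

Lemma conjRM s t r : conjR (s * t)%g r = conjR s (conjR t r).
Proof.
by apply: endDP => v; rewrite !conjRE invgM !twistM.
Qed.

Lemma conjR1 r : conjR 1%g r = r.
Proof. by apply: endDP => v; rewrite conjRE invg1 !twist1. Qed.

Lemma conjRK s : cancel (conjR s) (conjR s^-1%g).
Proof. by move=> r; rewrite -conjRM mulVg conjR1. Qed.

Lemma conjRVK s : cancel (conjR s^-1%g) (conjR s).
Proof. by move=> r; rewrite -conjRM mulgV conjR1. Qed.

Fact conjR_image s g : conjR s @` end_comp compV V0 g = end_comp compV V0 g.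
Proof.
apply/seteqP; split=> [_ [r rg <-]|r rg]; first exact: conjR_comp.
by exists (conjR s^-1%g r); [apply: conjR_comp | apply: conjRVK].
Qed.

Definition conj_stab s : stabilizer (end_comp compV V0) :=
  @Stabilizer _ _ _ _ (conjR s : {lrmorphism R -> R})
    (Bijective (conjRK s) (conjRVK s)) (conjR_image s).

Lemma conj_stabM s t : conj_stab (s * t)%g = (conj_stab s * conj_stab t)%g.
Proof. by apply: stabP => r; apply: conjRM. Qed.

(** A twist fixes [b ord0], by the normalization in [scal], so it can be read off its
    conjugation. *)
Lemma conj_stab_rank1 s v : conj_stab s (rank1 v ord0) (b ord0) = twist s v.
Proof.
rewrite /= conjRE twist_basis /scal unlift_none ract1.
by rewrite rank1_basis eqxx.
Qed.

(** The twist determines the automorphism through its values on the [b ord0 ** d], and the units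
    through its values on the other basis vectors. *)
Lemma conj_stab_inj : injective conj_stab.
Proof.
move=> s t st.
have tw v : twist s v = twist t v by rewrite -!conj_stab_rank1 st.
have right d : sd_right s d = sd_right t d.
  have := congr1 (coord^~ ord0) (tw (b ord0 ** d)).
  rewrite !coord_twist coord_ract coord_basis eqxx mul1r.
  by rewrite /scal unlift_none !mul1r.
have left : sd_left s = sd_left t.
  apply/ffunP => j; apply: unit_val_inj.
  have := congr1 (coord^~ (lift ord0 j)) (tw (b (lift ord0 j))).
  by rewrite !coord_twist coord_basis eqxx !rmorph1 !mulr1 /scal liftK.
case: s t left right {st tw} => [x f] [y g] /= -> fg.
by congr Semidirect; apply: stabP.
Qed.

(** * Every element of the stabilizer is a conjugation by a twist *)

Hypothesis bfine : forall i j m l,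
  i != j -> (i, j) != (m, l) -> ~ T (h i - h j - (h m - h l)).

Lemma coord_off i l t v : T t -> compV (h i + t) v -> l != i -> coord v l = 0.
Proof.
move=> tT vit li; apply/eqP/negPn/negP => c0.
(* The pair [(i, i)] has difference 0, so here the fine condition says that [h i] and [h l] are
   distinct modulo [T]. *)
apply: (bfine (m := i) (l := i) (i := i) (j := l)); first by rewrite eq_sym.
  by rewrite xpair_eqE eqxx.
rewrite subrr subr0.
have cT : T (h i + t - h l) by exists (coord v l) => //; apply: coord_comp.
by have := supportB hD cT tT; rewrite addrAC addrK.
Qed.

Section Conjugator.
Variable psi : stabilizer (end_comp compV V0).

(** The image of E_ij keeps the degree [h i - h j]. A nonzero entry at [(m, l)] would make this
    congruent to [h m - h l] modulo [T], which the fine condition forbids for [l != j]. *)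
Lemma stab_offdiag i j l : i != j -> l != j -> psi (rank1 (b i) j) (b l) = 0.
Proof.
move=> ij lj; apply: eq_coord => m; rewrite coord0.
apply/eqP/negPn/negP => c0.
apply: (bfine (i := i) (j := j) (m := m) (l := l) ij).
  by rewrite xpair_eqE negb_and [j == l]eq_sym lj orbT.
exists (coord (psi (rank1 (b i) j) (b l)) m) => //.
rewrite opprB addrA; apply: coord_comp.
exact: (stab_in psi (rank1_comp j (bh i))) (bh l).
Qed.

(* The map [v |-> psi (rank1 v 0) b_0] intertwines every r with psi r, since
   r (rank1 v 0) = rank1 (r v) 0. *)
Definition conjugator (v : V) : V := psi (rank1 v ord0) (b ord0).

Lemma conjugatorE (r : R) v : psi r (conjugator v) = conjugator (r v).
Proof. by rewrite /conjugator -mul_rank1 rmorphM. Qed.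

Lemma conjugatorD u v : conjugator (u + v) = conjugator u + conjugator v.
Proof. by rewrite /conjugator rank1D raddfD. Qed.

Lemma conjugator0 : conjugator 0 = 0.
Proof. by apply: (addrI (conjugator 0)); rewrite -conjugatorD !addr0. Qed.

Lemma conjugator_comp g v : compV g v -> compV g (conjugator v).
Proof.
move=> vg; have /(_ _ _ (bh ord0)) := stab_in psi (rank1_comp ord0 vg).
by rewrite subrK.
Qed.

(** The candidate for the component of [psi] in the stabilizer of the grading on [D]. *)
Definition base_aut (d : D) : D := coord (conjugator (b ord0 ** d)) ord0.

Lemma conjugator_base d : conjugator (b ord0 ** d) = b ord0 ** base_aut d.
Proof.
pose P d := forall l, l != ord0 -> coord (conjugator (b ord0 ** d)) l = 0.
have Pd : P d.
  (* By additivity it suffices to treat homogeneous [d], whose degree is in [T] when [d] is nonzero;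
     [coord_off] then applies. *)
  apply: (direct_sum_ind dsumD (P := P)) => [l _|x y xP yP l l0|t x xt l l0].
  - by rewrite ract0 conjugator0 coord0.
  - by rewrite ractDr conjugatorD coordD xP ?yP ?addr0.
  have [->|x0] := eqVneq x 0; first by rewrite ract0 conjugator0 coord0.
  apply: (coord_off (t := t) _ _ l0); first by exists x.
  by apply: conjugator_comp; apply: compVM.
rewrite [LHS]coordE (bigD1 ord0) //= big1 ?addr0 // => l l0.
by rewrite Pd ?ract0.
Qed.

Lemma base_aut_comp g d : compD g d -> compD g (base_aut d).
Proof.
move=> dg; have := coord_comp ord0 (conjugator_comp (compVM (bh ord0) dg)).
by rewrite addrAC subrr add0r.
Qed.

Lemma base_autD c d : base_aut (c + d) = base_aut c + base_aut d.
Proof. by rewrite /base_aut ractDr conjugatorD coordD. Qed.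

(** The vector [v ** d] is the image of [b ord0 ** d] under [rank1 v ord0], and the conjugator
    intertwines this map with its image under [psi]. *)
Lemma conjugator_ract v d : conjugator (v ** d) = conjugator v ** base_aut d.
Proof.
rewrite /conjugator -linear_ract -conjugator_base conjugatorE.
by rewrite rank1E coord_ract coord_basis eqxx mul1r.
Qed.

Lemma base_autM c d : base_aut (c * d) = base_aut c * base_aut d.
Proof. by rewrite {1}/base_aut -ractA conjugator_ract coord_ract. Qed.

Lemma base_aut_scale a d : base_aut (a *: d) = a *: base_aut d.
Proof.
rewrite /base_aut -mulr_algr -ractA /conjugator -scale_rank1 linearZ /=.
rewrite -/(conjugator _); set w := conjugator _.
change (coord (w ** a%:A) ord0 = a *: coord w ord0).
by rewrite coord_ract mulr_algr.
Qed.

(** On the corner E_00 R E_00, a copy of [D], [psi] acts as [base_aut]. Bijectivity of [psi] thus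
    passes to [base_aut]. *)
Lemma stab_rank1_base d :
  psi (rank1 (b ord0 ** d) ord0) = rank1 (b ord0 ** base_aut d) ord0.
Proof.
apply: endD_basis => l; rewrite rank1_basis eq_sym.
case: eqVneq => [->|l0]; first exact: conjugator_base.
(* Factoring through E_l0 on the right lets [stab_offdiag] kill the value at [b l]. *)
have -> : rank1 (b ord0 ** d) ord0 =
    rank1 (b ord0 ** d) l * rank1 (b l) ord0.
  by rewrite mul_rank1 rank1_basis eqxx.
by rewrite rmorphM /= stab_offdiag // linear0.
Qed.

(** Multiplicativity makes [base_aut 1] idempotent. It is nonzero since [psi] is injective, and
    homogeneous, hence invertible and equal to 1. *)
Lemma base_aut1 : base_aut 1 = 1.
Proof.
have f10 : base_aut 1 != 0.
  apply/eqP => f10; have := stab_rank1_base 1; rewrite f10 ract0 ract1.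
  have -> : rank1 0 ord0 = 0.
    by apply: endDP => w; rewrite rank1E /ract scaler0.
  rewrite -(rmorph0 psi) => /(bij_inj (stab_bij psi)).
  move/(congr1 (fun r : R => r (b ord0))); rewrite rank1_basis eqxx.
  exact/eqP/(free_neq0 bfree).
have [x [_ xf]] := hD.2 _ _ (base_aut_comp (graded_one hD.1)) f10.
by rewrite -[LHS]mul1r -{1}xf -mulrA -base_autM mulr1.
Qed.

Fact base_aut_linear : linear base_aut.
Proof. by move=> a c d; rewrite base_autD base_aut_scale. Qed.

HB.instance Definition _ :=
  GRing.isLinear.Build F D D _ base_aut base_aut_linear.
HB.instance Definition _ :=
  GRing.isMonoidMorphism.Build D D base_aut (base_aut1, base_autM).

End Conjugator.

Lemma stabVK (psi : stabilizer (end_comp compV V0)) : cancel psi (psi^-1)%g.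
Proof.
move=> r.
exact: (congr1 (fun f : stabilizer (end_comp compV V0) => f r) (mulVg psi)).
Qed.

Lemma base_autK psi : cancel (base_aut psi) (base_aut (psi^-1)%g).
Proof.
move=> d; have := stabVK psi (rank1 (b ord0 ** d) ord0).
rewrite !stab_rank1_base => /(congr1 (fun r : R => coord (r (b ord0)) ord0)).
by rewrite !rank1_basis eqxx !coord_ract coord_basis eqxx !mul1r.
Qed.

Lemma base_autVK psi : cancel (base_aut (psi^-1)%g) (base_aut psi).
Proof. by rewrite -{2}[psi]invgK; apply: base_autK. Qed.

Fact base_aut_image psi g : base_aut psi @` compD g = compD g.
Proof.
apply/seteqP; split=> [_ [d dg <-]|d dg]; first exact: base_aut_comp.
by exists (base_aut (psi^-1)%g d); [apply: base_aut_comp | apply: base_autVK].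
Qed.

Definition base_stab psi : stabilizer compD :=
  @Stabilizer _ _ _ _ (base_aut psi : {lrmorphism D -> D})
    (Bijective (base_autK psi) (base_autVK psi)) (base_aut_image psi).

Lemma conjugator_basis psi i : exists x : U,
  conjugator psi (b i) = b i ** unit_val x.
Proof.
have e : conjugator psi (b i) = b i ** coord (conjugator psi (b i)) i.
  rewrite [LHS]coordE (bigD1 i) //= big1 ?addr0 // => l li.
  rewrite (coord_off (support0 hD) _ li) ?ract0 // addr0.
  exact: conjugator_comp.
have c : compD 0 (coord (conjugator psi (b i)) i).
  by rewrite -(subrr (h i)); apply/coord_comp/conjugator_comp.
have c0 : coord (conjugator psi (b i)) i != 0.
  (* If the coefficient vanished, so would the conjugator at [b i], and then at [b ord0], the image
     of [b i] under E_0i; but the conjugator fixes [b ord0]. *)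
  apply: contra_neq (free_neq0 bfree ord0) => c0.
  rewrite -[b ord0]ract1 -(base_aut1 psi) -conjugator_base ract1.
  have {1}-> : b ord0 = rank1 (b ord0) i (b i) by rewrite rank1_basis eqxx.
  by rewrite -conjugatorE e c0 ract0 linear0.
by exists (IdentityUnit hD c c0).
Qed.

Lemma conj_stab_surj psi : exists s, conj_stab s = psi.
Proof.
have /choice[u uE] := conjugator_basis psi.
exists (Semidirect (componentwise_action hD n)
  [ffun j => u (lift ord0 j)] (base_stab psi)).
set s := Semidirect _ _ _.
(* Both maps are additive and semilinear for the same automorphism, so comparing them on the basis
   suffices; at index 0 both fix [b ord0]. *)
have twE v : twist s v = conjugator psi v.
  rewrite [in RHS](coordE v).
  rewrite (big_morph _ (conjugatorD psi) (conjugator0 psi)).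
  apply: eq_bigr => i _; rewrite conjugator_ract -ractA; congr (_ ** _).
  rewrite /scal; case: unliftP => [j ->|->]; first by rewrite ffunE uE.
  by rewrite -{2}[b ord0]ract1 conjugator_base base_aut1.
apply: stabP => r; apply: endDP => v.
by rewrite /= conjRE twE -conjugatorE -twE twistVK.
Qed.

End Twist.

(** Needed because [conj_stab] goes from the semidirect product to the stabilizer, against the
    direction of the final isomorphism. *)
Lemma mul_bij_inverse (H K : groupType) (f : H -> K) :
  {morph f : x y / (x * y)%g} -> bijective f ->
  exists g : {multiplicative K -> H}, bijective g.
Proof.
move=> fM [g fK gK].
have gM : {morph g : x y / (x * y)%g}.
  by move=> x y; apply: (can_inj fK); rewrite fM !gK.
pose gm : {multiplicative K -> H} :=
  HB.pack_for {multiplicative K -> H} g (isMultiplicative.Build K H g gM).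
by exists gm; exists f.
Qed.

Theorem proposition13 (F : fieldType) (G : zmodType)
    (D : algType F) (Gamma0 : G -> set D) (hD : graded_division Gamma0)
    (V : lmodType D^c) (compV : G -> set V) (hV : graded_module Gamma0 compV)
    (V0 : exists v : V, v != 0)
    (k : nat) (hk : has_dim compV setT k)
    (hfine : fine_condition Gamma0 compV) :
  exists phi : {multiplicative stabilizer (end_comp compV V0)
                  -> semidirect (componentwise_action hD k.-1)},
    bijective phi.
Proof.
have [b [bP bspan bfree]] := hk.
have {bP} /choice[h bh] : forall i, exists g, compV g (b i).
  by move=> i; have [] := bP i.
have {}bspan v : exists d, v = \sum_i b i ** d i by apply: bspan.
case: k b bspan bfree h bh {hk} => [|n] b bspan bfree h bh.
  (* An empty basis would force [V] to be zero. *)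
  have [v /eqP[]] := V0; have [d ->] := bspan v.
  by rewrite big_ord0.
have bfine := fine_basis hD hV bh bfree hfine.
apply: mul_bij_inverse (conj_stabM V0 hV bh bspan bfree) _.
have /choice[g gK] := conj_stab_surj (V0 := V0) hD hV bh bspan bfree bfine.
by exists g => // s; apply: conj_stab_inj (gK _).
Qed.
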